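(* Consider the network system $\bm\Sigma$ with $N$ agents and its reduced-order model $\bm{\hat\Sigma}$ with $k$ agents. If the agent system is not reduced (i.e. $r=n$ and $(\hat A,\hat B,\hat C)=(A,B,C)$), then $$\|\bm\Sigma-\bm{\hat\Sigma}\|_{\mathcal H_\infty}=\|\mathbf{\Sigma_s}-\mathbf{\hat\Sigma_s}\|_{\mathcal H_\infty}\le2\sum_{i=k}^{N-1}\sum_{j=1}^{n}\sigma_i\tau_j .$$
   Context: Original data. Agents: $\dot x_i=Ax_i+B\nu_i$, $\eta_i=Cx_i$ with $A\in\mathbb{R}^{n\times n}$, $B\in\mathbb{R}^{n\times m}$, $C\in\mathbb{R}^{m\times n}$, minimal and passive. Passive means that there is a symmetric positive definite $K$ with $A^\top K+KA\le0$, $C=B^\top K$. Let $K_m$, $K_M$ be the minimum and maximum (Loewner order) symmetric positive definite solutions $K$ of these relations. $L\in\mathbb{R}^{N\times N}$ is the Laplacian of a connected undirected weighted graph ($L_{ij}=-w_{ij}$ for $i\neq j$, $L_{ii}=\sum_{j\ne i}w_{ij}$, $w_{ij}=w_{ji}\ge0$), $F\in\mathbb{R}^{N\times p}$, $H\in\mathbb{R}^{q\times N}$. The network system is $$\bm\Sigma:\ \dot x=(I_N\otimes A-L\otimes BC)x+(F\otimes B)u,\quad y=(H\otimes C)x .$$ Fix $L=T\,\mathrm{blkdiag}(\bar\Lambda,0)T^\top$ with $T=[T_1\ T_2]$ orthogonal, $T_2=\mathbf 1_N/\sqrt N$, $\bar\Lambda=\mathrm{blkdiag}(\bar\lambda_1I_{m_1},\dots,\bar\lambda_sI_{m_s})$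 with $\bar\lambda_1>\cdots>\bar\lambda_s>0$ the distinct nonzero eigenvalues of $L$. Set $\bar F=T_1^\top F$, $\bar H=HT_1$, and $$\mathbf{\Sigma_s}:\ \dot z_s=(I_{N-1}\otimes A-\bar\Lambda\otimes BC)z_s+(\bar F\otimes B)u,\quad y_s=(\bar H\otimes C)z_s .$$ Balancing. $X=X^\top>0$ satisfies $-\bar\Lambda X-X\bar\Lambda+\bar F\bar F^\top=0$, and $Y=\mathrm{blkdiag}(Y_1,\dots,Y_s)$, $Y_i=Y_i^\top>0$ in $\mathbb{R}^{m_i\times m_i}$, satisfies $-\bar\Lambda Y-Y\bar\Lambda+\bar H^\top\bar H\le0$. A nonsingular $T_{\mathcal G}$ satisfies $T_{\mathcal G}XT_{\mathcal G}^\top=T_{\mathcal G}^{-\top}YT_{\mathcal G}^{-1}=\mathrm{diag}(\sigma_1,\dots,\sigma_{N-1})$ with $\sigma_1\ge\cdots\ge\sigma_{N-1}$ (the square roots of the eigenvalues of $XY$), and $\tau_1\ge\cdots\ge\tau_n$ are the square roots of the eigenvalues of $K_M^{-1}K_m$. Truncation to $k\le N$ nodes. $(\hat\Lambda_1,\hat F_1,\hat H_1)$ consists of the leading $(k-1)\times(k-1)$ block of $T_{\mathcal G}\bar\Lambda T_{\mathcal G}^{-1}$, the first $k-1$ rows of $T_{\mathcal G}\bar F$, and the first $k-1$ columns of $\bar HT_{\mathcal G}^{-1}$. With $(\hat A,\hat B,\hat C)$ the reduced agent model (here equal to $(A,B,C)$), $$\mathbf{\hat\Sigma_s}:\ \dot{\hat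 z}_s=(I_{k-1}\otimes\hat A-\hat\Lambda_1\otimes\hat B\hat C)\hat z_s+(\hat F_1\otimes\hat B)u,\quad \hat y_s=(\hat H_1\otimes\hat C)\hat z_s .$$ Reduced network. Put $$\mathcal N=\begin{bmatrix}\hat\Lambda_1&0\\0&0\end{bmatrix},\quad \mathcal F=\begin{bmatrix}\hat F_1\\ \tfrac1{\sqrt N}\mathbf 1_N^\top F\end{bmatrix},\quad \mathcal H=\begin{bmatrix}\hat H_1&\tfrac1{\sqrt N}H\mathbf 1_N\end{bmatrix}.$$ $\mathcal T_n$ is a nonsingular matrix such that $\hat L=\mathcal T_n^{-1}\mathcal N\mathcal T_n$ is the Laplacian of a connected undirected weighted graph on $k$ nodes, $\hat F=\mathcal T_n^{-1}\mathcal F$, $\hat H=\mathcal H\mathcal T_n$, and $$\bm{\hat\Sigma}:\ \dot{\hat x}=(I_k\otimes\hat A-\hat L\otimes\hat B\hat C)\hat x+(\hat F\otimes\hat B)u,\quad \hat y=(\hat H\otimes\hat C)\hat x .$$ $\|\bm\Sigma_1-\bm\Sigma_2\|_{\mathcal H_\infty}$ denotes the $\mathcal H_\infty$-norm of the difference of the transfer functions (from $u$ to output) of the two systems, taken as a rational matrix function after cancellations. *)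

(* Defs.v *)
From HB Require Import structures.
From mathcomp Require Import all_boot all_order all_algebra.
From mathcomp Require Import fraction mxtens complex.
From mathcomp Require Import all_classical all_reals all_analysis.

Set Implicit Arguments.
Unset Strict Implicit.
Unset Printing Implicit Defensive.

Import Order.TTheory GRing.Theory Num.Theory.

Local Open Scope classical_set_scope.
Local Open Scope ring_scope.

Section RealMatrices.
Variable R : realType.

(* The Loewner order; it is only applied to symmetric matrices. *)
Definition loewner_le (n : nat) (M1 M2 : 'M[R]_n) : Prop :=
  forall x : 'cV[R]_n, 0 <= (x^T *m (M2 - M1) *m x) 0 0.

Definition sym_posdef (n : nat) (M : 'M[R]_n) : Prop :=
  M^T = M /\ forall x : 'cV[R]_n, x != 0 -> 0 < (x^T *m M *m x) 0 0.

(* d lists, in non-increasing order, the nonnegative square roots of the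
   eigenvalues of M, counted with algebraic multiplicity. *)
Definition sqrt_eigenvalues (n : nat) (M : 'M[R]_n) (d : 'I_n -> R) : Prop :=
  [/\ forall i, 0 <= d i,
      forall i j : 'I_n, (i <= j)%N -> d j <= d i
    & char_poly M = \prod_(i < n) ('X - (d i ^+ 2)%:P)].

(* Diagonal entries of the weight matrix w (self-loops) play no role. *)
Definition connected_laplacian (n : nat) (L : 'M[R]_n) : Prop :=
  exists w : 'M[R]_n,
    [/\ forall i j, 0 <= w i j /\ w i j = w j i,
        forall i j, i != j -> L i j = - w i j,
        forall i, L i i = \sum_(j < n | j != i) w i j
      & forall i j, connect [rel a b | (a != b) && (0 < w a b)] i j].

End RealMatrices.

Section Systems.
Variable R : realType.

Record lti (n m q : nat) := Lti {
  lti_A : 'M[R]_n;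
  lti_B : 'M[R]_(n, m);
  lti_C : 'M[R]_(q, n) }.

Definition controllable (n m q : nat) (S : lti n m q) : bool :=
  row_free (\mxrow_(i < n) (lti_A S ^+ i *m lti_B S)).

Definition observable (n m q : nat) (S : lti n m q) : bool :=
  row_full (\mxcol_(i < n) (lti_C S *m lti_A S ^+ i)).

Definition minimal (n m q : nat) (S : lti n m q) : bool :=
  controllable S && observable S.

Definition storage (n m : nat) (S : lti n m m) (K : 'M[R]_n) : Prop :=
  [/\ sym_posdef K,
      loewner_le ((lti_A S)^T *m K + K *m lti_A S) 0
    & lti_C S = (lti_B S)^T *m K].

Definition passive (n m : nat) (S : lti n m m) : Prop :=
  exists K : 'M[R]_n, storage S K.

Definition min_storage (n m : nat) (S : lti n m m) (Km : 'M[R]_n) : Prop :=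
  storage S Km /\ forall K, storage S K -> loewner_le Km K.

Definition max_storage (n m : nat) (S : lti n m m) (KM : 'M[R]_n) : Prop :=
  storage S KM /\ forall K, storage S K -> loewner_le K KM.

(* All four systems (the network, its synchronization part, and their
   reductions) have this form; M is the interconnection matrix. *)
Definition network (n m N p q : nat) (S : lti n m m)
    (M : 'M[R]_N) (F : 'M[R]_(N, p)) (H : 'M[R]_(q, N)) :
    lti (N * n) (p * m) (q * m) :=
  Lti (1%:M *t lti_A S - M *t (lti_B S *m lti_C S))
      (F *t lti_B S) (H *t lti_C S).

(* C (s I - A)^-1 B as a matrix of rational functions: s is the indeterminate,
   so s I - A is always invertible and common factors cancel by construction. *)
Definition transfer (n m q : nat) (S : lti n m q) :
    'M[{fraction {poly R}}]_(q, m) :=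
  let cst r := tofrac (r%:P : {poly R}) in
  map_mx cst (lti_C S) *m
  invmx (map_mx (@tofrac _) (char_poly_mx (lti_A S))) *m
  map_mx cst (lti_B S).

(* G is regular at s (each entry can be written as a fraction whose
   denominator does not vanish at s) and takes the value M there. *)
Definition ratmx_value (q m : nat) (G : 'M[{fraction {poly R}}]_(q, m))
    (s : R[i]) (M : 'M[R[i]]_(q, m)) : Prop :=
  forall i j, exists a b : {poly R},
    [/\ (map_poly (real_complex R) b).[s] != 0,
        G i j = tofrac a / tofrac b
      & M i j = (map_poly (real_complex R) a).[s] /
                (map_poly (real_complex R) b).[s]].

Definition cnorm2 (n : nat) (v : 'cV[R[i]]_n) : R :=
  Num.sqrt (\sum_(i < n)
    (complex.Re (v i 0) ^+ 2 + complex.Im (v i 0) ^+ 2)).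

(* The largest singular value, as the operator norm for Euclidean norms. *)
Definition spectral_norm (q m : nat) (M : 'M[R[i]]_(q, m)) : \bar R :=
  ereal_sup [set (cnorm2 (M *m v))%:E | v in [set v | cnorm2 v <= 1]].

(* The norm of the Hardy space H_infty: the supremum of the spectral norm over
   the open right half-plane. Poles there, on the imaginary axis or at infinity
   make it +oo. *)
Definition hinf_norm (q m : nat) (G : 'M[{fraction {poly R}}]_(q, m)) :
    \bar R :=
  ereal_sup [set e | exists s : R[i], 0 < complex.Re s /\
    ((exists2 M, ratmx_value G s M & e = spectral_norm M) \/
     ((forall M, ~ ratmx_value G s M) /\ e = +oo%E))].

End Systems.

(* Main.v *)
Require Import Defs.
From HB Require Import structures.
From mathcomp Require Import all_boot all_order all_algebra.
From mathcomp Require Import fraction mxtens complex ring.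
From mathcomp Require Import all_classical all_reals all_analysis.

(** Equality. In suitable coordinates each network is the direct sum of its
    synchronisation part and of a single averaged agent with interconnection matrix 0,
    input [1^T F / sqrt N] and output [H 1 / sqrt N] ([transfer_similar_block]). The
    averaged agent is the same for the original and for the reduced network, so it
    cancels from the difference of the transfer matrices before any norm is taken.

    Bound. The norm is a supremum over the open right half-plane, so it is enough to fix
    [s] with [Re s > 0] and to bound the error at [s] ([hinf_norm_le]). Everything is then
    linear algebra over the complex numbers.

    The Kronecker products of [X] with [KM^-1] and of [Y] with [Km] satisfy the two
    Lyapunov inequalities of the synchronised system: passivity of the agents takes care
    of the terms in [A], and [C = B^T K] lets the interconnection term combine with the
    graph-level inequalities for [X] and [Y] ([balanced_network_bound]). With [T] such
    that [KM = T^* T] and [Km = T^* D T] ([simultaneous_diag]) and with the given [TG],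
    these two Gramians become diagonal, with weights [P] and [Q] such that state [(i, j)]
    has [P Q = (sigma i * tau j) ^ 2] ([network_bound]).

    Removing one state of weights [P a], [Q a] from a system with diagonal
    Gramians changes the output by at most [2 * sqrt (P a * Q a)] times the input
    ([remove_one_state]); the proof is the usual storage function of balanced
    truncation, read at the frequency [s] instead of along trajectories. The Lyapunov
    inequalities survive the removal, and also show that [s] is never a pole
    ([solution_eq0]). Deleting a node means removing its [n] states one by one, so the
    errors [2 * sigma i * tau j] add up ([truncation_error], [truncation_bound]). *)

Set Implicit Arguments.
Unset Strict Implicit.
Unset Printing Implicit Defensive.

Import Order.TTheory GRing.Theory Num.Theory.

Local Open Scope ring_scope.
Local Open Scope sesquilinear_scope.

Lemma entryD (V : nmodType) m n (M N : 'M[V]_(m, n)) i j :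
  (M + N) i j = M i j + N i j.
Proof. by rewrite mxE. Qed.

Lemma entryB (V : zmodType) m n (M N : 'M[V]_(m, n)) i j :
  (M - N) i j = M i j - N i j.
Proof. by rewrite !mxE. Qed.

(** * Hermitian positive matrices as Gram matrices *)

Section Adjoint.
Variable C : numClosedFieldType.

Lemma adjmxM m n p (M : 'M[C]_(m, n)) (N : 'M[C]_(n, p)) :
  (M *m N)^t* = N^t* *m M^t*.
Proof. by rewrite trmx_mul map_mxM. Qed.

Lemma adjmxD m n (M N : 'M[C]_(m, n)) : (M + N)^t* = M^t* + N^t*.
Proof. by rewrite linearD /= map_mxD. Qed.

Lemma adjmxN m n (M : 'M[C]_(m, n)) : (- M)^t* = - M^t*.
Proof. by rewrite linearN /= map_mxN. Qed.

Lemma adjmx1 n : (1%:M : 'M[C]_n)^t* = 1%:M.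
Proof. by rewrite trmx1 map_mx1. Qed.

Lemma adjmx_tens m n p q (M : 'M[C]_(m, n)) (N : 'M[C]_(p, q)) :
  (M *t N)^t* = M^t* *t N^t*.
Proof. by rewrite trmx_tens map_mxT. Qed.

Lemma adjmx_diag_ge0 n (d : 'I_n -> C) : (forall i, 0 <= d i) ->
  (diag_mx (\row_i d i))^t* = diag_mx (\row_i d i).
Proof.
move=> d_ge0; rewrite tr_diag_mx map_diag_mx; congr diag_mx; apply/rowP => i.
by rewrite !mxE; apply: conj_Creal; rewrite ger0_real.
Qed.

(** Squares are kept throughout: a bound by [a ^+ 2 * sqnorm u] is polynomial in the
    data, and only the triangle inequality needs actual norms. *)
Definition sqnorm n (v : 'cV[C]_n) : C := \sum_i `|v i 0| ^+ 2.

Lemma sqnormE n (v : 'cV[C]_n) : sqnorm v = (v^t* *m v) 0 0.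
Proof. by rewrite mxE; apply: eq_bigr => i _; rewrite !mxE mulrC normCK. Qed.

Lemma sqnorm_ge0 n (v : 'cV[C]_n) : 0 <= sqnorm v.
Proof. by apply: sumr_ge0 => i _; rewrite exprn_ge0. Qed.

Lemma sqnorm_minkowski n (v w : 'cV[C]_n) a b c : 0 <= a -> 0 <= b -> 0 <= c ->
  sqnorm v <= a ^+ 2 * c -> sqnorm w <= b ^+ 2 * c -> sqnorm (v + w) <= (a + b) ^+ 2 * c.
Proof.
have dotE (u : 'cV[C]_n) : sqnorm u = dotmx u^T u^T :> C.
  rewrite dotmxE !mxE.
  by apply: eq_bigr => i _; rewrite !mxE normCK.
move=> a_ge0 b_ge0 c_ge0 le_v le_w.
have sq_le (u : 'cV[C]_n) e : 0 <= e -> sqnorm u <= e ^+ 2 * c ->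
    sqrtC (sqnorm u) <= e * sqrtC c :> C.
  move=> e_ge0 le_u; rewrite -(@ler_pXn2r _ 2) ?nnegrE ?mulr_ge0 ?sqrtC_ge0 ?sqnorm_ge0 //.
  by rewrite exprMn !sqrtCK.
have le_vw : sqrtC (sqnorm (v + w)) <= sqrtC (sqnorm v) + sqrtC (sqnorm w) :> C.
  by rewrite !dotE linearD; have [] := triangle_lerif (@dotmx C n) v^T w^T.
rewrite -[sqnorm _]sqrtCK -[c]sqrtCK -exprMn.
rewrite ler_pXn2r ?nnegrE ?mulr_ge0 ?addr_ge0 ?sqrtC_ge0 ?sqnorm_ge0 //.
by apply: le_trans le_vw _; rewrite mulrDl lerD ?sq_le.
Qed.

(** A Gram factorisation rather than a sign condition on the quadratic form: this is
    the formulation that passes through Kronecker products in one line. *)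
Definition psd n (M : 'M[C]_n) := exists r (G : 'M[C]_(r, n)), M = G^t* *m G.

Lemma psd_ge0 n (M : 'M[C]_n) (z : 'cV_n) : psd M -> 0 <= (z^t* *m M *m z) 0 0.
Proof.
by move=> [r [G ->]]; rewrite mulmxA -adjmxM -mulmxA -sqnormE sqnorm_ge0.
Qed.

(** How a Lyapunov inequality is used: tested on a vector [z], it bounds the output
    energy [sqnorm (Y *m z)] by the dissipation [- 2 Re h]. With [M = Q A] it is the
    observability inequality, with [M = A P] and [Y = B^*] the controllability one. *)
Lemma psd_lyapunov r n (M : 'M[C]_n) (Y : 'M[C]_(r, n)) (z : 'cV_n) :
  psd (- (M + M^t* + Y^t* *m Y)) ->
  let h := (z^t* *m M *m z) 0 0 in h + h^* + sqnorm (Y *m z) <= 0.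
Proof.
move=> /(psd_ge0 z) M_ge0 /=; set h := (z^t* *m M *m z) 0 0; move: M_ge0.
rewrite mulmxN mulNmx mxE oppr_ge0 !mulmxDr !mulmxDl !entryD -/h.
have -> : z^t* *m M^t* *m z = (z^t* *m M *m z)^t* by rewrite !adjmxM trmxCK mulmxA.
have -> : z^t* *m (Y^t* *m Y) *m z = (Y *m z)^t* *m (Y *m z) by rewrite adjmxM !mulmxA.
by rewrite -sqnormE 2!mxE -/h.
Qed.

Lemma psdD n (M N : 'M[C]_n) : psd M -> psd N -> psd (M + N).
Proof.
move=> [r [G ->]] [r' [G' ->]]; exists (r + r')%N, (col_mx G G').
by rewrite tr_col_mx map_row_mx mul_row_col.
Qed.

Lemma psd_gram r n (G : 'M[C]_(r, n)) : psd (G^t* *m G).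
Proof. by exists r, G. Qed.

Lemma psd0 n : psd (0 : 'M[C]_n).
Proof. by exists 0%N, 0; rewrite mulmx0. Qed.

Lemma psd_congr m n (M : 'M[C]_m) (P : 'M[C]_(m, n)) :
  psd M -> psd (P^t* *m M *m P).
Proof.
by move=> [r [G ->]]; exists r, (G *m P); rewrite adjmxM !mulmxA.
Qed.

Lemma psd_tens m n (M : 'M[C]_m) (N : 'M[C]_n) : psd M -> psd N -> psd (M *t N).
Proof.
move=> [r [G ->]] [r' [G' ->]]; exists (r * r')%N, (G *t G').
by rewrite adjmx_tens tensmx_mul.
Qed.

Lemma psd_diag n (d : 'I_n -> C) : (forall i, 0 <= d i) ->
  psd (diag_mx (\row_i d i)).
Proof.
move=> d_ge0; exists n, (diag_mx (\row_i sqrtC (d i))).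
rewrite adjmx_diag_ge0 => [|i]; last by rewrite sqrtC_ge0.
rewrite mulmx_diag; congr diag_mx; apply/rowP => i.
by rewrite !mxE -expr2 sqrtCK.
Qed.

Lemma hermitian_diag n (M : 'M[C]_n) : M^t* = M ->
  exists2 U : 'M[C]_n, U \is unitarymx &
  exists d : 'I_n -> C, M = U^t* *m diag_mx (\row_i d i) *m U.
Proof.
move=> Mh.
have /hermitian_normalmx/orthomx_spectralP : M \is hermsymmx.
  by apply/is_hermitianmxP; rewrite /= expr0 scale1r Mh.
have U_unit := spectral_unitarymx M.
rewrite (invmx_unitary U_unit) => ME.
exists (spectralmx M) => //; exists (fun i => spectral_diag M 0 i).
by rewrite {1}ME; congr (_ *m diag_mx _ *m _); apply/rowP => i; rewrite mxE.
Qed.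

Lemma diag_form n (d : 'I_n -> C) (z : 'cV[C]_n) :
  (z^t* *m diag_mx (\row_i d i) *m z) 0 0 = \sum_i d i * `|z i 0| ^+ 2.
Proof.
rewrite -mulmxA mul_diag_mx mxE; apply: eq_bigr => i _.
by rewrite !mxE normCK mulrC -mulrA.
Qed.

(** Testing the form on an eigenvector reads off an eigenvalue; this turns sign
    conditions on the form into sign conditions on the spectrum. *)
Lemma hermitian_diag_form n (U : 'M[C]_n) (d : 'I_n -> C) i :
  U \is unitarymx ->
  let z := U^t* *m delta_mx i (0 : 'I_1) in
  (z^t* *m (U^t* *m diag_mx (\row_i d i) *m U) *m z) 0 0 = d i /\ z != 0.
Proof.
move=> U_unit z.
have Uz : U *m z = delta_mx i 0.
  by rewrite mulmxA (unitarymxP U_unit) mul1mx.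
split.
  have -> D : z^t* *m (U^t* *m D *m U) *m z = (U *m z)^t* *m D *m (U *m z).
    by rewrite adjmxM !mulmxA.
  rewrite Uz diag_form (bigD1 i) //= big1 => [|j ne_ji].
    by rewrite !mxE !eqxx /= normr1 expr1n mulr1 addr0.
  by rewrite mxE (negbTE ne_ji) /= normr0 expr0n mulr0.
apply/eqP => z0; move: Uz; rewrite z0 mulmx0 => /matrixP /(_ i 0).
by rewrite !mxE !eqxx /= => /esym/eqP; rewrite oner_eq0.
Qed.

Lemma form_psd n (M : 'M[C]_n) : M^t* = M ->
  (forall z : 'cV_n, 0 <= (z^t* *m M *m z) 0 0) -> psd M.
Proof.
move=> /hermitian_diag[U U_unit [d ->]] M_ge0.
apply/psd_congr/psd_diag => i.
by have [<- _] := hermitian_diag_form d i U_unit; apply: M_ge0.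
Qed.

Definition posdef n (M : 'M[C]_n) :=
  M^t* = M /\ forall z : 'cV_n, z != 0 -> 0 < (z^t* *m M *m z) 0 0.

Lemma posdef_diag n (M : 'M[C]_n) : posdef M ->
  exists2 U : 'M[C]_n, U \is unitarymx &
  exists2 d : 'I_n -> C, forall i, 0 < d i & M = U^t* *m diag_mx (\row_i d i) *m U.
Proof.
move=> [/hermitian_diag[U U_unit [d ->]] M_gt0]; exists U => //; exists d => // i.
by have [<- z_neq0] := hermitian_diag_form d i U_unit; apply: M_gt0.
Qed.

(** Factor [K1 = G^* G]; then [G^-* K2 G^-1] is again Hermitian, and the unitary that
    diagonalises it does not disturb [K1] once it has become the identity. *)
Lemma simultaneous_diag n (K1 K2 : 'M[C]_n) : posdef K1 -> posdef K2 ->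
  exists2 T : 'M[C]_n, T \in unitmx &
  exists2 d : 'I_n -> C, forall i, 0 < d i &
    K1 = T^t* *m T /\ K2 = T^t* *m diag_mx (\row_i d i) *m T.
Proof.
move=> K1_pd [K2h K2pd].
have [U1 U1_unitary [d1 d1_gt0 K1E]] := posdef_diag K1_pd.
pose r1 i := sqrtC (d1 i); pose G := diag_mx (\row_i r1 i) *m U1.
have r1_gt0 i : 0 < r1 i by rewrite sqrtC_gt0.
have K1G : K1 = G^t* *m G.
  rewrite adjmxM adjmx_diag_ge0 => [|i]; last exact: ltW.
  rewrite mulmxA -(mulmxA _ (diag_mx _) (diag_mx _)) mulmx_diag K1E.
  congr (_ *m diag_mx _ *m _); apply/rowP => i.
  by rewrite !mxE -expr2 sqrtCK.
have G_unit : G \in unitmx.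
  rewrite unitmx_mul [X in _ && X]unitarymx_unit // andbT unitmxE det_diag unitfE.
  by apply/prodf_neq0 => i _; rewrite mxE gt_eqF.
(* from here on only the factorisation [K1 = G^* G] matters *)
clearbody G.
have GhV : G^t* *m (invmx G)^t* = 1%:M by rewrite -adjmxM mulVmx // adjmx1.
pose M := (invmx G)^t* *m K2 *m invmx G.
have Mh : M^t* = M by rewrite !adjmxM trmxCK K2h mulmxA.
have Mpd (z : 'cV[C]_n) : z != 0 -> 0 < (z^t* *m M *m z) 0 0.
  move=> z_neq0; have -> : z^t* *m M *m z = (invmx G *m z)^t* *m K2 *m (invmx G *m z).
    by rewrite adjmxM !mulmxA.
  apply: K2pd; apply: contra_neq z_neq0 => Gz0.
  by rewrite -[z](mulKVmx G_unit) Gz0 mulmx0.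
have [U U_unitary [d d_gt0 ME]] := posdef_diag (conj Mh Mpd).
exists (U *m G); first by rewrite unitmx_mul unitarymx_unit.
exists d => //; split.
  rewrite adjmxM mulmxA -(mulmxA _ _ U).
  have /mulmx1C-> : U *m U^t* = 1%:M by apply/unitarymxP.
  by rewrite mulmx1.
rewrite adjmxM.
have -> : G^t* *m U^t* *m diag_mx (\row_i d i) *m (U *m G)
   = G^t* *m (U^t* *m diag_mx (\row_i d i) *m U) *m G by rewrite !mulmxA.
by rewrite -ME /M !mulmxA GhV mul1mx mulmxKV.
Qed.

End Adjoint.

Lemma ker0_unitmx (F : fieldType) n (M : 'M[F]_n) :
  (forall z : 'cV_n, M *m z = 0 -> z = 0) -> M \in unitmx.
Proof.
move=> M0; rewrite -unitmx_tr -row_free_unit; apply: inj_row_free => v vM.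
apply: trmx_inj; rewrite trmx0; apply: M0.
by apply: trmx_inj; rewrite trmx_mul trmxK vM trmx0.
Qed.

(** * Removing states one at a time, at a fixed frequency *)

Section Truncation.
Variables (C : numClosedFieldType) (d m q : nat).
Variables (A : 'M[C]_d) (B : 'M[C]_(d, m)) (Co : 'M[C]_(q, d)).
Variables (P Q g : 'I_d -> C) (s : C).
Hypothesis P_gt0 : forall i, 0 < P i.
Hypothesis Q_gt0 : forall i, 0 < Q i.
Hypothesis g_ge0 : forall i, 0 <= g i.
Hypothesis gE : forall i, g i ^+ 2 = P i * Q i.
Let DP := diag_mx (\row_i P i).
Let DQ := diag_mx (\row_i Q i).
Hypothesis ctrl : psd (- (A *m DP + (A *m DP)^t* + B *m B^t*)).
Hypothesis obs : psd (- (DQ *m A + (DQ *m A)^t* + Co^t* *m Co)).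
Hypothesis s_gt0 : 0 < s + s^*.

(** The equation [(s - A) x = B u] truncated to the states in [S]. All truncations live
    in the same space, the removed states being held at zero, so that solutions for
    different [S] can be added and subtracted. *)
Definition solution (S : {set 'I_d}) (u : 'cV[C]_m) (x : 'cV[C]_d) :=
  forall a, if a \in S then s * x a 0 = (A *m x + B *m u) a 0 else x a 0 = 0.

(** A homogeneous solution satisfies [x^* Q A x = s x^* Q x], since [Q] is diagonal and
    [x] vanishes off [S]. The observability inequality then gives
    [2 Re s * x^* Q x <= 0]. Hence no truncation has a pole with [Re s > 0]. *)
Lemma solution_eq0 S x : solution S 0 x -> x = 0.
Proof.
move=> xS; have := psd_lyapunov x obs => /=.
have -> : (x^t* *m (DQ *m A) *m x) 0 0 = s * \sum_a Q a * `|x a 0| ^+ 2.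
  rewrite -!mulmxA mulmxA mxE mulr_sumr; apply: eq_bigr => a _.
  have := xS a; rewrite mulmx0 addr0; set y := (A *m x) a 0.
  rewrite mul_mx_diag !mxE normCK; case: ifP => [_ <-|_ ->]; last by rewrite conjC0; ring.
  ring.
set t := \sum_a _.
have t_ge0 : 0 <= t by apply: sumr_ge0 => a _; rewrite mulr_ge0 ?exprn_ge0 // ltW.
rewrite rmorphM /= (conj_Creal (ger0_real t_ge0)) -mulrDl => le0.
have t0 : t = 0.
  apply/eqP; rewrite eq_le t_ge0 andbT -(pmulr_rle0 _ s_gt0).
  by apply: le_trans le0; rewrite lerDl sqnorm_ge0.
move/eqP: t0; rewrite psumr_eq0 => [/allP x0|a _]; last by rewrite mulr_ge0 ?exprn_ge0 // ltW.
apply/colP => a; rewrite mxE; apply/eqP.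
by have := x0 a (mem_index_enum a); rewrite mulf_eq0 gt_eqF //= sqrf_eq0 normr_eq0.
Qed.

Lemma solution_unique S u x y : solution S u x -> solution S u y -> x = y.
Proof.
move=> xS yS; apply/eqP; rewrite -subr_eq0; apply/eqP/(@solution_eq0 S) => a.
have := xS a; have := yS a; case: ifP => _ ya xa.
  by rewrite mulmx0 addr0 mulmxBr !mxE mulrBr; move: xa ya; rewrite !mxE => -> ->; ring.
by rewrite !mxE xa ya subrr.
Qed.

(** With [Pi] the projection on [S], solutions are those of
    [(s - Pi A) x = Pi B u]; uniqueness makes this matrix invertible. *)
Lemma solution_exists S u : exists x, solution S u x.
Proof.
pose Pi : 'M[C]_d := diag_mx (\row_a (a \in S)%:R).
pose M := s%:M - Pi *m A.
have s_neq0 : s != 0.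
  by apply: contraTneq s_gt0 => ->; rewrite conjC0 addr0 ltxx.
have PiE (v : 'cV[C]_d) a : (Pi *m v) a 0 = (a \in S)%:R * v a 0 by rewrite mul_diag_mx !mxE.
have solP w x : M *m x = Pi *m B *m w -> solution S w x.
  move=> /colP Mx a; have := Mx a.
  rewrite mulmxBl mul_scalar_mx -!mulmxA entryB !PiE.
  rewrite [(s *: x) _ _]mxE entryD.
  case: ifP => aS; rewrite ?mul1r ?mul0r ?subr0.
    by move=> <-; rewrite addrC subrK.
  by move/eqP; rewrite mulf_eq0 (negbTE s_neq0) /= => /eqP.
have M_unit : M \in unitmx.
  apply: ker0_unitmx => z z0; apply: (@solution_eq0 S); apply: solP.
  by rewrite z0 mulmx0.
exists (invmx M *m (Pi *m B *m u)); apply: solP.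
by rewrite mulKVmx.
Qed.

(** The heart of the error bound. Put [de = x - y] and [p = x + y], and add the
    observability inequality at [de] to [g a ^+ 2] times the controllability inequality
    at [z = P^-1 p]. The equations of [x] and [y] make the state terms equal to [s] times
    a nonnegative number [t]: on [S] each of the two forms contributes a square, and at
    the removed state, where [de] and [p] both equal [x], the weights agree precisely
    because [g a ^+ 2 = P a * Q a], so that the two half-equations recombine into the
    equation of [x]. The terms left contain the input and are absorbed by completing the
    square in [v - 2 u], with [v = B^* z]. This is the frequency-domain form of the usual
    storage function for balanced truncation. *)
Lemma remove_one_state (S : {set 'I_d}) a u x y : a \notin S ->
  solution (a |: S) u x -> solution S u y ->
  sqnorm (Co *m (x - y)) <= (2 * g a) ^+ 2 * sqnorm u.
Proof.
move=> aS xS yS.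
pose de := x - y; pose p := x + y; pose z := \col_b ((P b)^-1 * p b 0).
have Pz : DP *m z = p.
  by apply/colP => b; rewrite mul_diag_mx !mxE mulVKf // gt_eqF.
pose v := B^t* *m z.
have obs_de := psd_lyapunov de obs.
have := psd_lyapunov z (Y := B^t*); rewrite trmxCK => /(_ _ ctrl) ctrl_z.
set ho := (_ *m de) 0 0 in obs_de; set hc := (_ *m z) 0 0 in ctrl_z.
rewrite /= in obs_de ctrl_z.
pose e := (v^t* *m u) 0 0.
have sqnorm_sub : 0 <= sqnorm v - 2 * e - 2 * e^* + 4 * sqnorm u.
  have := sqnorm_ge0 (v - 2 *: u); rewrite !sqnormE.
  have -> : (v - 2 *: u)^t* = v^t* - 2 *: u^t*.
    by rewrite adjmxD adjmxN linearZ /= map_mxZ /= conjC_nat.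
  rewrite mulmxBl !mulmxBr -!scalemxAl -!scalemxAr.
  rewrite !mxE -/(sqnorm _) => H; apply: le_trans H _.
  have -> : \sum_j (u^t*) 0 j * v j 0 = e^*.
    rewrite /e mxE rmorph_sum; apply: eq_bigr => j _.
    by rewrite !mxE rmorphM /= conjCK mulrC.
  have -> : \sum_j (v^t*) 0 j * u j 0 = e by rewrite /e mxE.
  rewrite le_eqVlt; apply/orP; left; apply/eqP; ring.
(* [t] is the value of the storage function *)
pose t := \sum_b (if b == a then 2 * Q a * `|x a 0| ^+ 2 else
           if b \in S then Q b * `|de b 0| ^+ 2 + g a ^+ 2 * (P b)^-1 * `|p b 0| ^+ 2 else 0).
have t_ge0 : 0 <= t.
  apply: sumr_ge0 => b _; case: ifP => _; last case: ifP => // _.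
    by rewrite !mulr_ge0 ?exprn_ge0 // ltW.
  by rewrite addr_ge0 ?mulr_ge0 ?exprn_ge0 ?invr_ge0 // ltW.
have key : ho + g a ^+ 2 * hc + 2 * g a ^+ 2 * e = s * t.
  have -> : ho = \sum_b Q b * (de b 0)^* * (A *m de) b 0.
    rewrite /ho -!mulmxA mulmxA mxE; apply: eq_bigr => b _.
    rewrite mul_mx_diag !mxE; ring.
  have -> : hc = \sum_b (P b)^-1 * (p b 0)^* * (A *m p) b 0.
    rewrite /hc -!mulmxA Pz mxE; apply: eq_bigr => b _.
    by rewrite !mxE rmorphM /= (conj_Creal (ger0_real _)) // invr_ge0 ltW.
  have -> : e = \sum_b (P b)^-1 * (p b 0)^* * (B *m u) b 0.
    rewrite /e adjmxM trmxCK -mulmxA mxE; apply: eq_bigr => b _.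
    by rewrite !mxE rmorphM /= (conj_Creal (ger0_real _)) // invr_ge0 ltW.
  rewrite !mulr_sumr -!big_split /=; apply: eq_bigr => b _.
  have := xS b; have := yS b; rewrite finset.in_setU1.
  rewrite /de /p mulmxBr mulmxDr !(entryB, entryD).
  have [->|_] := eqVneq b a; rewrite /=.
    rewrite (negbTE aS) => -> sx.
    have PQ : g a ^+ 2 * (P a)^-1 = Q a by rewrite gE mulrAC mulfV ?mul1r ?gt_eqF.
    rewrite normCK -PQ subr0 addr0.
    have -> : s * (2 * (g a ^+ 2 / P a) * (x a 0 * (x a 0)^*))
      = 2 * (g a ^+ 2 / P a) * (s * x a 0) * (x a 0)^* by ring.
    rewrite sx; ring.
  case: ifP => _ yb xb; last by rewrite xb yb subrr addr0 conjC0; ring.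
  rewrite !normCK.
  have -> : s * (Q b * ((x b 0 - y b 0) * (x b 0 - y b 0)^*) +
       g a ^+ 2 / P b * ((x b 0 + y b 0) * (x b 0 + y b 0)^*))
   = Q b * (s * x b 0 - s * y b 0) * (x b 0 - y b 0)^* +
     g a ^+ 2 / P b * (s * x b 0 + s * y b 0) * (x b 0 + y b 0)^* by ring.
  rewrite xb yb; ring.
have gR : (g a)^* = g a by apply/conj_Creal/ger0_real.
have keyC : ho^* + g a ^+ 2 * hc^* + 2 * g a ^+ 2 * e^* = s^* * t.
  have /(congr1 Num.conj) := key.
  by rewrite !rmorphD !rmorphM /= conjC_nat !gR (conj_Creal (ger0_real t_ge0)).
rewrite -subr_ge0.
have -> : (2 * g a) ^+ 2 * sqnorm u - sqnorm (Co *m de) =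
  - (ho + ho^* + sqnorm (Co *m de)) + g a ^+ 2 * - (hc + hc^* + sqnorm v)
  + g a ^+ 2 * (sqnorm v - 2 * e - 2 * e^* + 4 * sqnorm u) + (s + s^*) * t.
  rewrite [(s + _) * t]mulrDl -key -keyC; ring.
by rewrite !addr_ge0 ?mulr_ge0 ?exprn_ge0 ?oppr_ge0 // ltW.
Qed.

(** The weights of the remaining states still satisfy both inequalities after a state
    has been removed, so the states outside [S] can be removed in any order, and the
    errors add up by the triangle inequality. *)
Lemma truncation_error (S : {set 'I_d}) u x y :
  solution finset.setT u x -> solution S u y ->
  sqnorm (Co *m (x - y)) <= (2 * \sum_(a | a \notin S) g a) ^+ 2 * sqnorm u.
Proof.
move=> xT; have [k] := ubnP #|~: S|; elim: k S y => // k IHk S y.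
rewrite ltnS => cardS yS.
have [S_full|] := eqVneq (~: S) finset.set0.
  have ST : S = finset.setT by rewrite -[S]finset.setCK S_full finset.setC0.
  rewrite ST in yS; rewrite (solution_unique xT yS) subrr mulmx0.
  by rewrite sqnormE mulmx0 mxE mulr_ge0 ?sqnorm_ge0 ?exprn_ge0 // mulr_ge0 ?sumr_ge0.
case/finset.set0Pn=> a; rewrite inE => aS.
have [w wS] := solution_exists (a |: S) u.
have card_lt : (#|~: (a |: S)| < k)%N.
  apply: leq_trans cardS; rewrite finset.setCU finset.setIC -finset.setDE.
  by rewrite [X in (_ <= X)%N](cardsD1 a) inE aS.
have le_xw := IHk _ _ card_lt wS.
have le_wy := remove_one_state aS wS yS.
have -> : Co *m (x - y) = Co *m (x - w) + Co *m (w - y).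
  by rewrite -mulmxDr addrA subrK.
rewrite (bigD1 a) //= [g a + _]addrC mulrDr.
rewrite (eq_bigl (fun b => b \notin a |: S)) => [|b]; last first.
  by rewrite finset.in_setU1 negb_or andbC.
apply: sqnorm_minkowski => //; last exact: sqnorm_ge0.
  by rewrite mulr_ge0 ?sumr_ge0.
by rewrite mulr_ge0.
Qed.

(** Solving a system whose matrices are cut down to the states [f 0, ..., f (k - 1)]
    amounts to a truncated solution in the large space, through the embedding [E]. *)
Lemma truncation_bound k (f : 'I_k -> 'I_d) (f_inj : injective f) :
  [/\ s%:M - A \in unitmx, s%:M - mxsub f f A \in unitmx
    & forall u : 'cV_m,
      sqnorm ((Co *m invmx (s%:M - A) *m B
            - colsub f Co *m invmx (s%:M - mxsub f f A) *m rowsub f B) *m u)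
      <= (2 * \sum_(a | a \notin codom f) g a) ^+ 2 * sqnorm u].
Proof.
pose E : 'M[C]_(d, k) := colsub f 1%:M.
have mE r (M : 'M[C]_(r, d)) : colsub f M = M *m E.
  apply/matrixP => i j; rewrite -[M in LHS]mulmx1 !mxE.
  by apply: eq_bigr => l _; rewrite !mxE.
have Em r (M : 'M[C]_(d, r)) : rowsub f M = E^T *m M.
  by rewrite rowsubE; congr (_ *m _); rewrite /E trmx_mxsub trmx1.
have EmE (M : 'M[C]_d) : mxsub f f M = E^T *m M *m E.
  by rewrite -Em -mE; apply/matrixP => i j; rewrite !mxE.
have Ez (z : 'cV_k) a : a \notin codom f -> (E *m z) a 0 = 0.
  move=> af; rewrite mxE big1 // => b _; rewrite !mxE.
  by case: eqVneq af => [->|]; rewrite ?codom_f // mul0r.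
have Efz (z : 'cV_k) b : (E *m z) (f b) 0 = z b 0.
  rewrite mxE (bigD1 b) //= !mxE eqxx mul1r big1 ?addr0 // => c cb.
  by rewrite !mxE (inj_eq f_inj) eq_sym (negbTE cb) mul0r.
have ETf r (M : 'M[C]_(d, r)) b j : (E^T *m M) b j = M (f b) j by rewrite -Em mxE.
pose S : {set 'I_d} := [set a | a \in codom f].
have sol_sub (z : 'cV_k) u :
    (s%:M - mxsub f f A) *m z = rowsub f B *m u -> solution S u (E *m z).
  move=> /colP zE a; rewrite inE; case: ifPn => [/codomP[b ->]|/Ez//].
  rewrite Efz; have := zE b; rewrite mulmxBl mul_scalar_mx EmE Em -!mulmxA.
  rewrite entryB !ETf [(s *: z) _ _]mxE => /(canRL (subrK _)) ->.
  by rewrite entryD addrC.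
have sol_all x u : (s%:M - A) *m x = B *m u -> solution finset.setT u x.
  move=> /colP xE a; rewrite inE; have := xE a; rewrite mulmxBl mul_scalar_mx.
  rewrite entryB [(s *: x) _ _]mxE => /(canRL (subrK _)) ->.
  by rewrite entryD addrC.
have A_unit : s%:M - A \in unitmx.
  by apply: ker0_unitmx => x x0; apply/(@solution_eq0 finset.setT)/sol_all; rewrite mulmx0.
have sA_unit : s%:M - mxsub f f A \in unitmx.
  apply: ker0_unitmx => z z0; have /solution_eq0 Ez0 : solution S 0 (E *m z).
    by apply: sol_sub; rewrite mulmx0.
  by apply/colP => b; rewrite -Efz Ez0 !mxE.
split=> // u.
rewrite mulmxBl mE -!mulmxA -mulmxBr.
have := @truncation_error S u (invmx (s%:M - A) *m (B *m u))
  (E *m (invmx (s%:M - mxsub f f A) *m (rowsub f B *m u))).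
under eq_bigl do rewrite inE.
by apply; [apply: sol_all|apply: sol_sub]; rewrite mulKVmx.
Qed.

End Truncation.

(** * Kronecker structure of networks *)

Section TensLinear.
Variable R : comNzRingType.

Lemma tensDl m n p q (A A' : 'M[R]_(m, n)) (B : 'M[R]_(p, q)) :
  (A + A') *t B = A *t B + A' *t B.
Proof. by apply/matrixP => i j; rewrite !mxE mulrDl. Qed.

Lemma tensDr m n p q (A : 'M[R]_(m, n)) (B B' : 'M[R]_(p, q)) :
  A *t (B + B') = A *t B + A *t B'.
Proof. by apply/matrixP => i j; rewrite !mxE mulrDr. Qed.

Lemma tensNl m n p q (A : 'M[R]_(m, n)) (B : 'M[R]_(p, q)) :
  (- A) *t B = - (A *t B).
Proof. by apply/matrixP => i j; rewrite !mxE mulNr. Qed.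

Lemma tensNr m n p q (A : 'M[R]_(m, n)) (B : 'M[R]_(p, q)) :
  A *t (- B) = - (A *t B).
Proof. by apply/matrixP => i j; rewrite !mxE mulrN. Qed.

Lemma tens_diag m n (a : 'I_m -> R) (b : 'I_n -> R) :
  diag_mx (\row_i a i) *t diag_mx (\row_j b j)
  = diag_mx (\row_l (a (mxtens_unindex l).1 * b (mxtens_unindex l).2)).
Proof.
apply/matrixP => i j; rewrite !mxE.
have [->|ij] := eqVneq i j; first by rewrite !eqxx !mulr1n.
case: eqP => [e1|_]; last by rewrite mul0r.
case: eqP => [e2|_]; last by rewrite mulr0.
case/eqP: ij; apply: (can_inj (@mxtens_unindexK m n)).
by rewrite [LHS]surjective_pairing e1 e2 -surjective_pairing.
Qed.

Definition netmx n m N (A : 'M[R]_n) (B : 'M[R]_(n, m)) (Co : 'M[R]_(m, n))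
  (M : 'M[R]_N) := 1%:M *t A - M *t (B *m Co).

(** The states of agent [h i] inside the large network are those of agent [i] in the
    small one. *)
Definition netsub N n k (h : 'I_k -> 'I_N) (l : 'I_(k * n)) : 'I_(N * n) :=
  mxtens_index (h (mxtens_unindex l).1, (mxtens_unindex l).2).

Lemma netsub_inj N n k (h : 'I_k -> 'I_N) : injective h ->
  injective (@netsub N n k h).
Proof.
move=> h_inj l l' /(can_inj (@mxtens_indexK N n)) ll'.
have e1 : (mxtens_unindex l).1 = (mxtens_unindex l').1 := h_inj _ _ (congr1 fst ll').
have e2 : (mxtens_unindex l).2 = (mxtens_unindex l').2 := congr1 snd ll'.
apply: (can_inj (@mxtens_unindexK k n)).
by rewrite [LHS]surjective_pairing e1 e2 -surjective_pairing.
Qed.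

Lemma codom_netsub N n k (h : 'I_k -> 'I_N) l :
  (l \in codom (@netsub N n k h)) = ((mxtens_unindex l).1 \in codom h).
Proof.
apply/codomP/codomP => [[l' ->]|[i hi]].
  by exists (mxtens_unindex l').1; rewrite /netsub mxtens_indexK.
exists (mxtens_index (i, (mxtens_unindex l).2)).
by rewrite /netsub mxtens_indexK -hi -[LHS]mxtens_unindexK -surjective_pairing.
Qed.

Lemma netmx_sub n m N k (h : 'I_k -> 'I_N) (A : 'M[R]_n) (B : 'M[R]_(n, m)) Co M :
  injective h ->
  netmx A B Co (mxsub h h M) = mxsub (netsub (n := n) h) (netsub h) (netmx A B Co M).
Proof.
move=> h_inj; apply/matrixP => i j; rewrite !mxE !mxtens_indexK /=.
by rewrite (inj_eq h_inj).
Qed.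

Lemma rowsub_tens N k n p m (h : 'I_k -> 'I_N) (F : 'M[R]_(N, p)) (B : 'M[R]_(n, m)) :
  rowsub h F *t B = rowsub (netsub h) (F *t B).
Proof. by apply/matrixP => i j; rewrite !mxE !mxtens_indexK. Qed.

Lemma colsub_tens N k n q m (h : 'I_k -> 'I_N) (H : 'M[R]_(q, N)) (B : 'M[R]_(m, n)) :
  colsub h H *t B = colsub (netsub h) (H *t B).
Proof. by apply/matrixP => i j; rewrite !mxE !mxtens_indexK. Qed.

Lemma oppr_regroup (V : zmodType) (a b x y z : V) :
  - (a - x + (b - y) + z) = - (a + b) + (x + y - z).
Proof.
rewrite !opprD !opprK -!addrA; congr (_ + _).
by rewrite [RHS]addrCA; congr (_ + _); rewrite addrCA.
Qed.

End TensLinear.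

Section NetworkBound.
Variable C : numClosedFieldType.

Lemma big_tens (V : nmodType) N n (P : pred 'I_N) (F : 'I_N -> 'I_n -> V) :
  \sum_(l : 'I_(N * n) | P (mxtens_unindex l).1)
     F (mxtens_unindex l).1 (mxtens_unindex l).2
  = \sum_(i | P i) \sum_j F i j.
Proof.
rewrite pair_big /= (reindex (@mxtens_unindex N n)) /=; last first.
  exists (@mxtens_index N n) => l _; [exact: mxtens_unindexK | exact: mxtens_indexK].
by apply: eq_bigl => l; rewrite andbT.
Qed.

(** When the two storage functions of the agents are [1] and [D], the Kronecker
    products [S * 1] and [S * D] solve the two Lyapunov inequalities of the whole network:
    the interconnection term [Lam * (B C)] carries the factor [B B^*] resp. [C^* C], so it
    combines with the input resp. output term into the graph-level inequality. The two
    weights of state [(i, j)] have product [sigma i ^+ 2 * d j]. *)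
Lemma balanced_network_bound n m N p q k (A : 'M[C]_n) (B : 'M[C]_(n, m)) Co
  (Lam : 'M[C]_N) (F : 'M[C]_(N, p)) (H : 'M[C]_(q, N)) (sigma : 'I_N -> C) (d : 'I_n -> C)
  (h : 'I_k -> 'I_N) (s : C) :
  injective h -> (forall i, 0 < sigma i) -> (forall j, 0 < d j) ->
  let S := diag_mx (\row_i sigma i) in let D := diag_mx (\row_j d j) in
  Co = B^t* -> Co = B^t* *m D ->
  psd (- (A + A^t*)) -> psd (- (D *m A + (D *m A)^t*)) ->
  psd (Lam *m S + (Lam *m S)^t* - F *m F^t*) ->
  psd (S *m Lam + (S *m Lam)^t* - H^t* *m H) ->
  0 < s + s^* ->
  [/\ s%:M - netmx A B Co Lam \in unitmx,
      s%:M - netmx A B Co (mxsub h h Lam) \in unitmx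
    & forall u : 'cV_(p * m),
      sqnorm (((H *t Co) *m invmx (s%:M - netmx A B Co Lam) *m (F *t B)
           - (colsub h H *t Co) *m invmx (s%:M - netmx A B Co (mxsub h h Lam))
              *m (rowsub h F *t B)) *m u)
      <= (2 * \sum_(i | i \notin codom h) \sum_j sigma i * sqrtC (d j)) ^+ 2 * sqnorm u].
Proof.
move=> h_inj sigma_gt0 d_gt0 S D CoB CoD A_dis A_disD Lam_ctrl Lam_obs s_gt0.
pose P l := sigma (@mxtens_unindex N n l).1 * 1.
pose Q l := sigma (@mxtens_unindex N n l).1 * d (mxtens_unindex l).2.
pose g l := sigma (@mxtens_unindex N n l).1 * sqrtC (d (mxtens_unindex l).2).
have S1 : diag_mx (\row_l P l) = S *t (1%:M : 'M[C]_n).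
  rewrite -diag_const_mx (_ : const_mx 1 = \row_(j < n) 1) ?tens_diag //.
  by apply/rowP => j; rewrite !mxE.
have SD : diag_mx (\row_l Q l) = S *t D by rewrite tens_diag.
have SC : S^t* = S by apply: adjmx_diag_ge0 => i; apply: ltW.
have DC : D^t* = D by apply: adjmx_diag_ge0 => i; apply: ltW.
have Co_D : Co^t* = D *m B by rewrite CoD adjmxM trmxCK DC.
rewrite netmx_sub // rowsub_tens colsub_tens.
rewrite -(big_tens (fun i => i \notin codom h) (fun i j => sigma i * sqrtC (d j))).
under eq_bigl do rewrite -codom_netsub.
apply: (@truncation_bound C _ _ _ _ _ _ P Q g).
- by move=> l; rewrite /P mulr1.
- by move=> l; rewrite mulr_gt0.
- by move=> l; rewrite mulr_ge0 ?sqrtC_ge0 // ltW.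
- by move=> l; rewrite exprMn sqrtCK /P /Q; ring.
- have -> : - (netmx A B Co Lam *m diag_mx (\row_i P i)
      + (netmx A B Co Lam *m diag_mx (\row_i P i))^t* + F *t B *m (F *t B)^t*)
    = S *t (- (A + A^t*)) + (Lam *m S + (Lam *m S)^t* - F *m F^t*) *t (B *m B^t*).
    rewrite S1 /netmx mulmxBl !tensmx_mul !mulmx1 mul1mx adjmxD adjmxN !adjmx_tens.
    rewrite SC tensmx_mul CoB [(B *m B^t*)^t*]adjmxM trmxCK.
    rewrite !tensDl tensNl tensNr tensDr.
    by rewrite oppr_regroup.
  apply: psdD; apply: psd_tens => //; first by apply: psd_diag => i; apply: ltW.
  by have := psd_gram (B^t* ); rewrite trmxCK.
- have -> : - (diag_mx (\row_i Q i) *m netmx A B Co Lam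
      + (diag_mx (\row_i Q i) *m netmx A B Co Lam)^t* + (H *t Co)^t* *m (H *t Co))
    = S *t (- (D *m A + (D *m A)^t*)) + (S *m Lam + (S *m Lam)^t* - H^t* *m H) *t (Co^t* *m Co).
    rewrite SD /netmx mulmxBr !tensmx_mul !mulmx1 adjmxD adjmxN !adjmx_tens.
    rewrite SC tensmx_mul mulmxA -Co_D.
    rewrite !tensDl tensNl tensNr tensDr [(Co^t* *m _)^t*]adjmxM trmxCK.
    by rewrite oppr_regroup.
  apply: psdD; apply: psd_tens => //; last exact: psd_gram.
  by apply: psd_diag => i; apply: ltW.
- exact: s_gt0.
- exact: netsub_inj.
Qed.

End NetworkBound.

(** * Changes of coordinates *)

Section Intertwining.
Variable R : comUnitRingType.

Lemma invmx_intertwine m n (M : 'M[R]_m) (M' : 'M[R]_n) (V : 'M[R]_(m, n)) :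
  M \in unitmx -> M' \in unitmx -> M *m V = V *m M' ->
  invmx M *m V = V *m invmx M'.
Proof.
move=> M_unit M'_unit MV; rewrite -[V in LHS](mulmxK M'_unit) -MV.
by rewrite -mulmxA mulKmx.
Qed.

Lemma resolvent_similar n p q (A A' V : 'M[R]_n) (B B' : 'M[R]_(n, p))
  (Co Co' : 'M[R]_(q, n)) (s : R) :
  V \in unitmx -> V *m A = A' *m V -> V *m B = B' -> Co = Co' *m V ->
  s%:M - A' \in unitmx ->
  s%:M - A \in unitmx /\
  Co *m invmx (s%:M - A) *m B = Co' *m invmx (s%:M - A') *m B'.
Proof.
move=> V_unit VA <- -> A'_unit.
have VsA : V *m (s%:M - A) = (s%:M - A') *m V.
  by rewrite mulmxBl mulmxBr -VA scalar_mxC.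
have A_unit : s%:M - A \in unitmx.
  by rewrite -[_ - A](mulKmx V_unit) VsA !unitmx_mul unitmx_inv V_unit A'_unit.
split=> //; rewrite !mulmxA; congr (_ *m _); rewrite -!mulmxA; congr (_ *m _).
by rewrite -(invmx_intertwine A'_unit A_unit (esym VsA)).
Qed.

Lemma netmx_similar n m N (A T : 'M[R]_n) (B : 'M[R]_(n, m)) Co (M TG : 'M[R]_N) :
  T \in unitmx -> TG \in unitmx ->
  (TG *t T) *m netmx A B Co M
  = netmx (T *m A *m invmx T) (T *m B) (Co *m invmx T) (TG *m M *m invmx TG)
    *m (TG *t T).
Proof.
move=> T_unit TG_unit; rewrite /netmx mulmxBl mulmxBr !tensmx_mul mul1mx mulmx1.
by rewrite !mulmxA !mulmxKV // -mulmxA mulmxKV.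
Qed.

Lemma tens11 m n : (1%:M : 'M[R]_m) *t (1%:M : 'M[R]_n) = 1%:M.
Proof.
have E k : (1%:M : 'M[R]_k) = diag_mx (\row_i 1).
  by rewrite -diag_const_mx; congr diag_mx; apply/rowP => i; rewrite !mxE.
by rewrite !E tens_diag; congr diag_mx; apply/rowP => i; rewrite !mxE mulr1.
Qed.

Lemma tens_unit m n (A : 'M[R]_m) (B : 'M[R]_n) :
  A \in unitmx -> B \in unitmx -> A *t B \in unitmx.
Proof.
move=> A_unit B_unit.
suff /mulmx1_unit[] : (A *t B) *m (invmx A *t invmx B) = 1%:M by [].
by rewrite tensmx_mul !mulmxV // tens11.
Qed.

End Intertwining.

Section Eigenvalues.
Variable C : numClosedFieldType.

Lemma char_poly_similar n (T A : 'M[C]_n) : T \in unitmx ->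
  char_poly (invmx T *m A *m T) = char_poly A.
Proof.
move=> T_unit; rewrite /char_poly.
have -> : char_poly_mx (invmx T *m A *m T)
  = map_mx polyC (invmx T) *m char_poly_mx A *m map_mx polyC T.
  rewrite /char_poly_mx !map_mxM mulmxBr mulmxBl; congr (_ - _).
  by rewrite scalar_mxC -mulmxA -map_mxM mulVmx // map_mx1 mulmx1.
rewrite !det_mulmx mulrAC -det_mulmx -map_mxM mulVmx //.
by rewrite map_mx1 det1 mul1r.
Qed.

(** The eigenvalues found by diagonalisation and those listed by a factorisation of the
    characteristic polynomial agree as multisets, which is enough for a symmetric sum. *)
Lemma sum_sqrt_eigenvalues n (M T : 'M[C]_n) (d t : 'I_n -> C) :
  T \in unitmx -> M = invmx T *m diag_mx (\row_i d i) *m T ->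
  (forall i, 0 <= t i) -> char_poly M = \prod_i ('X - (t i ^+ 2)%:P) ->
  \sum_i sqrtC (d i) = \sum_i t i.
Proof.
move=> T_unit -> t_ge0; rewrite char_poly_similar // char_poly_trig ?diag_mx_is_trig // => chE.
have eq_dt : perm_eq [seq d i | i : 'I_n] [seq t i ^+ 2 | i : 'I_n].
  apply/allP => x _ /=; rewrite -!mu_prod_XsubC !big_image /= -chE.
  by apply/eqP; congr (mup x _); apply: eq_bigr => i _; rewrite !mxE eqxx mulr1n.
have: \sum_(x <- [seq d i | i : 'I_n]) sqrtC x
    = \sum_(x <- [seq t i ^+ 2 | i : 'I_n]) sqrtC x :> C.
  exact: perm_big.
rewrite !big_image /= => ->.
by apply: eq_bigr => i _; rewrite sqrCK.
Qed.

End Eigenvalues.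

Section Bound.
Variable C : numClosedFieldType.

(** The complex counterpart of [storage], with [psd] in place of the Loewner order. *)
Definition complex_storage n m (A : 'M[C]_n) (B : 'M[C]_(n, m)) (Co : 'M[C]_(m, n)) K :=
  [/\ posdef K, psd (- (A^t* *m K + K *m A)) & Co = B^t* *m K].

(** Reduction to balanced coordinates. Writing [KM = T^* T] and [Km = T^* D T], the
    change of agent coordinates [T] turns [KM] into [1] and [Km] into [D], and the change
    of graph coordinates [TG] balances [X] and [Y]. Transfer functions do not see
    [TG * T]. The eigenvalues [d] of [KM^-1 Km] are the squares of the [tau j]. *)
Lemma network_bound n m N p q k (A : 'M[C]_n) (B : 'M[C]_(n, m)) Co KM Km
  (Lam X Y TG : 'M[C]_N) (F : 'M[C]_(N, p)) (H : 'M[C]_(q, N)) (sigma : 'I_N -> C)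
  (tau : 'I_n -> C) (h : 'I_k -> 'I_N) (s : C) :
  complex_storage A B Co KM -> complex_storage A B Co Km ->
  (forall j, 0 <= tau j) ->
  char_poly (invmx KM *m Km) = \prod_j ('X - (tau j ^+ 2)%:P) ->
  X^t* = X -> Y^t* = Y ->
  psd (Lam *m X + X *m Lam^t* - F *m F^t*) ->
  psd (Lam^t* *m Y + Y *m Lam - H^t* *m H) ->
  TG \in unitmx -> (forall i, 0 < sigma i) ->
  TG *m X *m TG^t* = diag_mx (\row_i sigma i) ->
  (invmx TG)^t* *m Y *m invmx TG = diag_mx (\row_i sigma i) ->
  injective h -> 0 < s + s^* ->
  let Lamt := TG *m Lam *m invmx TG in
  let Lam1 := mxsub h h Lamt in
  let F1 := rowsub h (TG *m F) in let H1 := colsub h (H *m invmx TG) in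
  [/\ s%:M - netmx A B Co Lam \in unitmx, s%:M - netmx A B Co Lam1 \in unitmx
    & forall u : 'cV_(p * m),
      sqnorm (((H *t Co) *m invmx (s%:M - netmx A B Co Lam) *m (F *t B)
           - (H1 *t Co) *m invmx (s%:M - netmx A B Co Lam1) *m (F1 *t B)) *m u)
      <= (2 * \sum_(i | i \notin codom h) \sum_j sigma i * tau j) ^+ 2 * sqnorm u].
Proof.
move=> [KM_pd KM_dis CoM] [Km_pd Km_dis Com] tau_ge0 tau_char XC YC X_lyap Y_lyap.
move=> TG_unit sigma_gt0 XE YE h_inj s_gt0 Lamt Lam1 F1 H1.
have [T T_unit [d d_gt0 [KME KmE]]] := simultaneous_diag KM_pd Km_pd.
set D := diag_mx _ in KmE; set S := diag_mx _ in XE YE.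
have adjV l (V : 'M[C]_l) : V \in unitmx -> (invmx V)^t* *m V^t* = 1%:M.
  by move=> V_unit; rewrite -adjmxM mulmxV // adjmx1.
have adjV' l (V : 'M[C]_l) : V \in unitmx -> V^t* *m (invmx V)^t* = 1%:M.
  by move=> V_unit; rewrite -adjmxM mulVmx // adjmx1.
pose At := T *m A *m invmx T; pose Bt := T *m B; pose Ct := Co *m invmx T.
have CtB : Ct = Bt^t* by rewrite /Ct CoM KME mulmxA mulmxK // adjmxM.
have CtD : Ct = Bt^t* *m D by rewrite /Ct Com KmE !mulmxA mulmxK // adjmxM.
have DC : D^t* = D by apply: adjmx_diag_ge0 => i; apply: ltW.
have At_dis : psd (- (At + At^t*)).
  have -> : - (At + At^t*) = (invmx T)^t* *m (- (A^t* *m KM + KM *m A)) *m invmx T.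
    rewrite mulmxN mulNmx mulmxDr mulmxDl KME !mulmxA mulmxK // adjV // mul1mx.
    by rewrite /At !adjmxM mulmxA [in RHS]addrC.
  exact: psd_congr.
have At_disD : psd (- (D *m At + (D *m At)^t*)).
  have -> : - (D *m At + (D *m At)^t*) = (invmx T)^t* *m (- (A^t* *m Km + Km *m A)) *m invmx T.
    rewrite mulmxN mulNmx mulmxDr mulmxDl KmE !mulmxA mulmxK // adjV // mul1mx.
    by rewrite /At !adjmxM DC !mulmxA [in RHS]addrC.
  exact: psd_congr.
have LamtS : Lamt *m S = TG *m (Lam *m X) *m TG^t* by rewrite -XE !mulmxA mulmxKV.
have SLamt : S *m Lamt = (invmx TG)^t* *m (Y *m Lam) *m invmx TG.
  by rewrite -YE !mulmxA mulmxKV.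
have Lam_ctrl : psd (Lamt *m S + (Lamt *m S)^t* - (TG *m F) *m (TG *m F)^t*).
  have -> : Lamt *m S + (Lamt *m S)^t* - (TG *m F) *m (TG *m F)^t*
    = (TG^t* )^t* *m (Lam *m X + X *m Lam^t* - F *m F^t*) *m TG^t*.
    rewrite LamtS trmxCK mulmxBr mulmxBl mulmxDr mulmxDl !adjmxM trmxCK XC.
    by rewrite !mulmxA.
  exact: psd_congr.
have Lam_obs : psd (S *m Lamt + (S *m Lamt)^t* - (H *m invmx TG)^t* *m (H *m invmx TG)).
  have -> : S *m Lamt + (S *m Lamt)^t* - (H *m invmx TG)^t* *m (H *m invmx TG)
    = (invmx TG)^t* *m (Lam^t* *m Y + Y *m Lam - H^t* *m H) *m invmx TG.
    rewrite SLamt [Lam^t* *m Y + _]addrC.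
    rewrite mulmxBr mulmxBl mulmxDr mulmxDl !adjmxM trmxCK YC.
    by rewrite !mulmxA.
  exact: psd_congr.
have [full_unit red_unit bound] :=
  balanced_network_bound h_inj sigma_gt0 d_gt0 CtB CtD At_dis At_disD Lam_ctrl Lam_obs s_gt0.
have tau_sum : \sum_j sqrtC (d j) = \sum_j tau j.
  apply: (sum_sqrt_eigenvalues T_unit _ tau_ge0 tau_char).
  have Th_unit : T^t* \in unitmx by case: (mulmx1_unit (adjV' _ _ T_unit)).
  have KM_unit : KM \in unitmx by rewrite KME unitmx_mul Th_unit.
  apply: (can_inj (mulKmx KM_unit)); rewrite mulKVmx // KME KmE.
  by rewrite -!mulmxA mulKVmx.
have TT_unit : TG *t T \in unitmx by apply: tens_unit.
have IT_unit : (1%:M : 'M[C]_k) *t T \in unitmx by apply: tens_unit => //; apply: unitmx1.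
have full_C : H *t Co = ((H *m invmx TG) *t Ct) *m (TG *t T).
  by rewrite tensmx_mul !mulmxKV.
have red_C : H1 *t Co = (H1 *t Ct) *m (1%:M *t T).
  by rewrite tensmx_mul mulmx1 mulmxKV.
have red_A := netmx_similar A B Co Lam1 T_unit (unitmx1 _ k).
rewrite invmx1 mulmx1 mul1mx in red_A.
have red_B : (1%:M *t T) *m (F1 *t B) = F1 *t Bt by rewrite tensmx_mul mul1mx.
have [full_unitA full_val] := resolvent_similar TT_unit
  (netmx_similar A B Co Lam T_unit TG_unit) (tensmx_mul TG T F B) full_C full_unit.
have [red_unitA red_val] := resolvent_similar IT_unit red_A red_B red_C red_unit.
split=> // u; rewrite full_val red_val.
have := bound u; under eq_bigr do rewrite -mulr_sumr tau_sum mulr_sumr.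
by [].
Qed.

End Bound.

(** If [E1] and [E2] intertwine [M] with [M1] and [M2], they intertwine the inverses too;
    decomposing the input along them splits the response. *)
Lemma resolvent_sum (R : comUnitRingType) n n1 n2 p q (M : 'M[R]_n) (M1 : 'M[R]_n1)
  (M2 : 'M[R]_n2) (B : 'M[R]_(n, p)) B1 B2 (Co : 'M[R]_(q, n)) E1 E2 :
  M \in unitmx -> M1 \in unitmx -> M2 \in unitmx ->
  M *m E1 = E1 *m M1 -> M *m E2 = E2 *m M2 -> B = E1 *m B1 + E2 *m B2 ->
  Co *m invmx M *m B
  = Co *m E1 *m invmx M1 *m B1 + Co *m E2 *m invmx M2 *m B2.
Proof.
move=> M_unit M1_unit M2_unit ME1 ME2 ->.
rewrite mulmxDr !mulmxA -!(mulmxA Co).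
by rewrite (invmx_intertwine M_unit M1_unit ME1) (invmx_intertwine M_unit M2_unit ME2).
Qed.

(** * Transfer matrices and their values *)

Section Transfer.
Variable R : realType.
Local Notation K := {fraction {poly R}}.

Definition cstfrac : R -> K := @tofrac {poly R} \o polyC.
HB.instance Definition _ := GRing.RMorphism.on cstfrac.

Lemma map_char_poly_mx_frac n (A : 'M[R]_n) :
  map_mx (@tofrac _) (char_poly_mx A) = (tofrac 'X)%:M - map_mx cstfrac A :> 'M[K]_n.
Proof. by rewrite /char_poly_mx map_mxB map_scalar_mx -map_mx_comp. Qed.

Lemma char_poly_mx_frac_unit n (A : 'M[R]_n) :
  (tofrac 'X)%:M - map_mx cstfrac A \in @unitmx K n.
Proof.
rewrite -map_char_poly_mx_frac unitmxE det_map_mx unitfE tofrac_eq0.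
exact/monic_neq0/char_poly_monic.
Qed.

Lemma transferE n m q (S : lti R n m q) :
  transfer S = map_mx cstfrac (lti_C S)
    *m invmx ((tofrac 'X)%:M - map_mx cstfrac (lti_A S)) *m map_mx cstfrac (lti_B S).
Proof. by rewrite /transfer map_char_poly_mx_frac. Qed.

Lemma transfer_sum n n1 n2 m q (S : lti R n m q) (S1 : lti R n1 m q)
  (S2 : lti R n2 m q) E1 E2 :
  lti_A S *m E1 = E1 *m lti_A S1 -> lti_A S *m E2 = E2 *m lti_A S2 ->
  lti_B S = E1 *m lti_B S1 + E2 *m lti_B S2 ->
  lti_C S *m E1 = lti_C S1 -> lti_C S *m E2 = lti_C S2 ->
  transfer S = transfer S1 + transfer S2.
Proof.
move=> AE1 AE2 BE CE1 CE2; rewrite !transferE -CE1 -CE2 !map_mxM.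
apply: resolvent_sum; rewrite ?char_poly_mx_frac_unit //.
- by rewrite mulmxBl mulmxBr -!map_mxM AE1 scalar_mxC.
- by rewrite mulmxBl mulmxBr -!map_mxM AE2 scalar_mxC.
- by rewrite BE map_mxD !map_mxM.
Qed.

Lemma transfer_network_sum n m N N1 N2 p q (S : lti R n m m)
  (M : 'M[R]_N) (M1 : 'M[R]_N1) (M2 : 'M[R]_N2) (F : 'M[R]_(N, p)) F1 F2 (H : 'M[R]_(q, N)) H1 H2
  (E1 : 'M[R]_(N, N1)) (E2 : 'M[R]_(N, N2)) :
  M *m E1 = E1 *m M1 -> M *m E2 = E2 *m M2 -> F = E1 *m F1 + E2 *m F2 ->
  H *m E1 = H1 -> H *m E2 = H2 ->
  transfer (network S M F H)
  = transfer (network S M1 F1 H1) + transfer (network S M2 F2 H2).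
Proof.
move=> ME1 ME2 FE HE1 HE2.
apply: (@transfer_sum _ _ _ _ _ _ _ _ (E1 *t 1%:M) (E2 *t 1%:M)) => /=.
- by rewrite mulmxBl mulmxBr !tensmx_mul !mul1mx !mulmx1 ME1.
- by rewrite mulmxBl mulmxBr !tensmx_mul !mul1mx !mulmx1 ME2.
- by rewrite !tensmx_mul !mul1mx -tensDl FE.
- by rewrite tensmx_mul mulmx1 HE1.
- by rewrite tensmx_mul mulmx1 HE2.
Qed.

Local Notation toC := (real_complex R).
(** Evaluation at a complex point is a ring morphism, so it commutes with determinants
    and adjugates; this is how values of rational matrices are computed. *)
Definition evalC (s : R[i]) : {poly R} -> R[i] := horner_eval s \o map_poly toC.
HB.instance Definition _ s := GRing.RMorphism.on (evalC s).

(** Cramer's rule writes each entry as a fraction over the characteristic polynomial,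
    which does not vanish at [s]. *)
Lemma transfer_value n m q (S : lti R n m q) (s : R[i]) :
  let A := map_mx toC (lti_A S) in
  s%:M - A \in unitmx ->
  ratmx_value (transfer S) s
    (map_mx toC (lti_C S) *m invmx (s%:M - A) *m map_mx toC (lti_B S)).
Proof.
move=> A sA_unit i j.
have evC (c : R) : evalC s c%:P = toC c.
  by rewrite /evalC /= map_polyC /horner_eval hornerC.
have ev_const k l (M : 'M[R]_(k, l)) : map_mx (evalC s) (map_mx polyC M) = map_mx toC M.
  by apply/matrixP => a b; rewrite !mxE evC.
have evX : evalC s 'X = s by rewrite /evalC /= map_polyX /horner_eval hornerX.
have evA : map_mx (evalC s) (char_poly_mx (lti_A S)) = s%:M - A.
  rewrite /char_poly_mx map_mxB map_scalar_mx /= evX -map_mx_comp.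
  by congr (_ - _); apply/matrixP => k l; rewrite !mxE; apply: evC.
have ev_det : evalC s (char_poly (lti_A S)) = \det (s%:M - A) by rewrite -evA det_map_mx.
pose num := map_mx polyC (lti_C S) *m \adj (char_poly_mx (lti_A S)) *m map_mx polyC (lti_B S).
exists (num i j), (char_poly (lti_A S)); split.
- by rewrite -[_.[s]]/(evalC s _) ev_det -unitfE -unitmxE.
- have := char_poly_mx_frac_unit (lti_A S).
  rewrite /transfer -map_char_poly_mx_frac => unitA; rewrite /invmx unitA.
  rewrite -scalemxAr -scalemxAl mxE mulrC det_map_mx; congr (_ / _).
  rewrite -map_mx_adj.
  have -> : tofrac (num i j) = (map_mx (@tofrac _) num) i j by rewrite [RHS]mxE.
  by rewrite /num !map_mxM -!map_mx_comp.
- rewrite /invmx sA_unit -scalemxAr -scalemxAl mxE mulrC.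
  rewrite -[RHS]/(evalC s (num i j) / evalC s (char_poly (lti_A S))) ev_det; congr (_ / _).
  have -> : evalC s (num i j) = (map_mx (evalC s) num) i j by rewrite [RHS]mxE.
  by rewrite /num !map_mxM map_mx_adj evA !ev_const.
Qed.

Lemma tofrac_neq0 (b : {poly R}) (s : R[i]) :
  (map_poly toC b).[s] != 0 -> tofrac b != 0 :> K.
Proof.
by apply: contra_neq => /eqP; rewrite tofrac_eq0 => /eqP->; rewrite rmorph0 horner0.
Qed.

Lemma ratmx_valueB m q (G G' : 'M[K]_(q, m)) s M M' :
  ratmx_value G s M -> ratmx_value G' s M' -> ratmx_value (G - G') s (M - M').
Proof.
move=> GM GM' i j.
have [a [b [b0 Gab Mab]]] := GM i j; have [a' [b' [b'0 Gab' Mab']]] := GM' i j.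
exists (a * b' - a' * b), (b * b').
split.
- by rewrite rmorphM hornerM mulf_neq0.
- rewrite !mxE Gab Gab' rmorphB !rmorphM /=.
  by rewrite -[in LHS]mulNr addf_div ?(@tofrac_neq0 _ s) // mulNr.
- rewrite !mxE Mab Mab' rmorphB !rmorphM /= hornerD hornerN !hornerM.
  by rewrite -[in LHS]mulNr addf_div // mulNr.
Qed.

(** Two representations of the same fraction have equal cross products, and
    evaluation preserves them. *)
Lemma ratmx_value_unique m q (G : 'M[K]_(q, m)) s M M' :
  ratmx_value G s M -> ratmx_value G s M' -> M = M'.
Proof.
move=> GM GM'; apply/matrixP => i j.
have [a [b [b0 Gab ->]]] := GM i j; have [a' [b' [b'0 Gab' ->]]] := GM' i j.
apply/eqP; rewrite eqr_div // -!hornerM -!rmorphM /=.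
suff -> : a * b' = a' * b by [].
apply/eqP; rewrite -(tofrac_eq) !rmorphM /= -eqr_div ?(@tofrac_neq0 _ s) //.
by rewrite -Gab -Gab'.
Qed.

(** * From pointwise bounds to the H-infinity norm *)

Lemma sqnorm_cnorm2 n (v : 'cV[R[i]]_n) : sqnorm v = toC (cnorm2 v ^+ 2).
Proof.
rewrite /cnorm2 sqr_sqrtr; last by apply: sumr_ge0 => i _; rewrite addr_ge0 ?sqr_ge0.
by rewrite rmorph_sum; apply: eq_bigr => i _; rewrite -add_Re2_Im2.
Qed.

Lemma spectral_norm_le m q (M : 'M[R[i]]_(q, m)) (c : R) : 0 <= c ->
  (forall v : 'cV_m, sqnorm (M *m v) <= toC c ^+ 2 * sqnorm v) ->
  (spectral_norm M <= c%:E)%E.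
Proof.
move=> c_ge0 Mc; apply: ge_ereal_sup => _ [v /= v1 <-]; rewrite lee_fin.
have := Mc v; rewrite !sqnorm_cnorm2 -rmorphXn -rmorphM /= lecR -exprMn => le2.
have norm_ge0 k (w : 'cV[R[i]]_k) : 0 <= cnorm2 w by apply: sqrtr_ge0.
rewrite ler_pXn2r ?nnegrE ?mulr_ge0 // in le2.
by apply: le_trans le2 _; rewrite ler_piMr.
Qed.

(** A value at every point of the open right half-plane excludes the poles there, for
    which the norm would be infinite. *)
Lemma hinf_norm_le m q (G : 'M[K]_(q, m)) (c : R) : 0 <= c ->
  (forall s : R[i], 0 < complex.Re s -> exists2 M, ratmx_value G s M &
     forall v : 'cV_m, sqnorm (M *m v) <= toC c ^+ 2 * sqnorm v) ->
  (hinf_norm G <= c%:E)%E.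
Proof.
move=> c_ge0 Gc; apply: ge_ereal_sup => e [s [s_gt0]].
have [M GM Mc] := Gc s s_gt0.
case=> [[M' GM' ->]|[noM _]]; last by have := noM M GM.
by rewrite (ratmx_value_unique GM' GM); apply: spectral_norm_le.
Qed.

(** * Complexification of the real data *)

Local Notation cm := (map_mx toC).

Lemma toC_conj (x : R) : (toC x)^* = toC x.
Proof. by apply/conj_Creal/complex_realP; exists x. Qed.

Lemma adjmx_real m n (M : 'M[R]_(m, n)) : (cm M)^t* = cm M^T.
Proof. by apply/matrixP => i j; rewrite !mxE toC_conj. Qed.

(** For symmetric [M] the cross terms between the real and imaginary parts cancel. *)
Lemma complex_form n (M : 'M[R]_n) (z : 'cV[R[i]]_n) : M^T = M ->
  let x := map_mx (@complex.Re R) z in let y := map_mx (@complex.Im R) z in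
  (z^t* *m cm M *m z) 0 0 = toC ((x^T *m M *m x) 0 0 + (y^T *m M *m y) 0 0).
Proof.
move=> M_sym x y.
have zE : z = cm x + 'i *: cm y.
  by apply/matrixP => i j; rewrite !mxE [LHS]complexE complexiE.
have zhE : z^t* = cm x^T - 'i *: cm y^T.
  by rewrite -!adjmx_real {1}zE adjmxD linearZ /= map_mxZ /= conjCi scaleNr.
have xy : x^T *m M *m y = y^T *m M *m x.
  have tr1 (U : 'M[R]_1) : U^T = U by apply/matrixP => i j; rewrite mxE !ord1.
  by rewrite -[LHS]tr1 !trmx_mul trmxK M_sym mulmxA.
have -> : z^t* *m cm M *m z = cm (x^T *m M *m x + y^T *m M *m y).
  rewrite zhE {1}zE mulmxBl mulmxDr !mulmxBl -!scalemxAl -!scalemxAr.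
  rewrite -!map_mxM xy map_mxD scalerA -expr2 sqrCi scaleN1r opprK.
  by rewrite addrA addrNK.
by rewrite !mxE.
Qed.

Lemma psd_complex n (M : 'M[R]_n) : M^T = M ->
  (forall x : 'cV_n, 0 <= (x^T *m M *m x) 0 0) -> psd (cm M).
Proof.
move=> M_sym M_ge0; apply: form_psd; first by rewrite adjmx_real M_sym.
by move=> z; rewrite complex_form // ler0c addr_ge0.
Qed.

Lemma posdef_complex n (M : 'M[R]_n) : sym_posdef M -> posdef (cm M).
Proof.
move=> [M_sym M_gt0]; split=> [|z z_neq0]; first by rewrite adjmx_real M_sym.
have M_ge0 (x : 'cV_n) : 0 <= (x^T *m M *m x) 0 0.
  by have [->|/M_gt0/ltW//] := eqVneq x 0; rewrite mulmx0 mxE.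
rewrite complex_form // (ltcR 0).
set x := map_mx _ z; set y := map_mx _ z.
have [x0|x_neq0] := eqVneq x 0; last by rewrite ltr_pwDl ?M_gt0 ?M_ge0.
rewrite ltr_pwDr ?M_gt0 ?M_ge0 //; apply: contra_neq z_neq0 => y0.
apply/matrixP => i j; rewrite mxE; apply/eqP; rewrite eq_complex /=.
have /matrixP/(_ i j) := x0; have /matrixP/(_ i j) := y0.
by rewrite !mxE => -> ->; rewrite !eqxx.
Qed.

Lemma psd_loewner n (M : 'M[R]_n) : M^T = M -> loewner_le M 0 -> psd (- cm M).
Proof.
move=> M_sym M_le0; rewrite -map_mxN; apply: psd_complex.
  by rewrite linearN /= M_sym.
by move=> x; have := M_le0 x; rewrite sub0r.
Qed.

Lemma storage_complexify n m (A : 'M[R]_n) (B : 'M[R]_(n, m)) Co K0 :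
  storage (Lti A B Co) K0 -> complex_storage (cm A) (cm B) (cm Co) (cm K0).
Proof.
move=> [K_pd K_dis /= CoE]; split; first exact: posdef_complex.
- rewrite adjmx_real -!map_mxM -map_mxD; apply: psd_loewner => //.
  by rewrite linearD /= !trmx_mul trmxK K_pd.1 addrC.
- by rewrite CoE map_mxM adjmx_real.
Qed.

End Transfer.

(** * Splitting off the average, and the error bound *)

Lemma tr_castmx_mxdiag (R : nzRingType) s (mu : 'I_s -> nat) (lam : 'I_s -> R) N
    (e : (\sum_(i < s) mu i)%N = N) :
  (castmx (e, e) (\mxdiag_(i < s) ((lam i)%:M : 'M[R]_(mu i))))^T
  = castmx (e, e) (\mxdiag_(i < s) ((lam i)%:M : 'M[R]_(mu i))).
Proof.
case: _ / e; rewrite castmx_id tr_mxdiag; apply: eq_mxdiag => i.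
exact: tr_scalar_mx.
Qed.

(** Both networks are, up to the coordinates [Tn], the direct sum of a synchronisation
    part and of one node with interconnection matrix [0], the average of the agents. *)
Lemma transfer_similar_block (R : realType) n m k p q (S : lti R n m m)
  (Tn : 'M[R]_(k + 1)) (Lam1 : 'M[R]_k) (F1 : 'M[R]_(k, p)) (f2 : 'M[R]_(1, p))
  (H1 : 'M[R]_(q, k)) (h2 : 'M[R]_(q, 1)) : Tn \in unitmx ->
  transfer (network S (invmx Tn *m block_mx Lam1 0 0 0 *m Tn)
    (invmx Tn *m col_mx F1 f2) (row_mx H1 h2 *m Tn))
  = transfer (network S Lam1 F1 H1) + transfer (network S (0 : 'M[R]_1) f2 h2).
Proof.
move=> Tn_unit.
apply: (@transfer_network_sum _ _ _ _ _ _ _ _ _ _ _ _ _ _ _ _ _ _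
  (invmx Tn *m col_mx 1%:M 0) (invmx Tn *m col_mx 0 1%:M)).
- rewrite mulmxA mulmxK // -!mulmxA; congr (_ *m _).
  by rewrite mul_block_col mul_col_mx !(mul0mx, mul1mx, mulmx1, addr0).
- rewrite mulmxA mulmxK // -mulmxA mul_block_col !(mulmx0, mul0mx, addr0).
  by rewrite col_mx0 mulmx0.
- rewrite -!mulmxA -mulmxDr !mul_col_mx !mul1mx !mul0mx add_col_mx.
  by rewrite addr0 add0r.
- by rewrite mulmxA mulmxK // mul_row_col mulmx1 mulmx0 addr0.
- by rewrite mulmxA mulmxK // mul_row_col mulmx1 mulmx0 add0r.
Qed.

(* N = N1 + 1 nodes, reduced to k = k1 + 1 nodes. *)
Theorem theorem15 (R : realType) (n m N1 k1 p q s : nat)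
  (* agents *)
  (A : 'M[R]_n) (B : 'M[R]_(n, m)) (C : 'M[R]_(m, n))
  (agent_minimal : minimal (Lti A B C))
  (agent_passive : passive (Lti A B C))
  (Km KM : 'M[R]_n)
  (Km_min : min_storage (Lti A B C) Km)
  (KM_max : max_storage (Lti A B C) KM)
  (* network *)
  (L : 'M[R]_(N1 + 1)) (F : 'M[R]_(N1 + 1, p)) (H : 'M[R]_(q, N1 + 1))
  (L_laplacian : connected_laplacian L)
  (* spectral decomposition of L *)
  (mu : 'I_s -> nat) (lam : 'I_s -> R)
  (mu_gt0 : forall i, (0 < mu i)%N)
  (lam_gt0 : forall i, 0 < lam i)
  (lam_decr : forall i j : 'I_s, (i < j)%N -> lam j < lam i)
  (mu_sum : (\sum_(i < s) mu i)%N = N1)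
  (Lam : 'M[R]_N1)
  (LamE : Lam = castmx (mu_sum, mu_sum) (\mxdiag_(i < s) ((lam i)%:M : 'M[R]_(mu i))))
  (T1 : 'M[R]_(N1 + 1, N1)) (T2 : 'cV[R]_(N1 + 1))
  (T2E : T2 = const_mx (Num.sqrt ((N1 + 1)%:R : R))^-1)
  (T_orthogonal : (row_mx T1 T2)^T *m row_mx T1 T2 = 1%:M)
  (L_decomp : L = row_mx T1 T2 *m block_mx Lam 0 0 0 *m (row_mx T1 T2)^T)
  (Fbar : 'M[R]_(N1, p)) (FbarE : Fbar = T1^T *m F)
  (Hbar : 'M[R]_(q, N1)) (HbarE : Hbar = H *m T1)
  (* balancing *)
  (X Y : 'M[R]_N1)
  (X_posdef : sym_posdef X)
  (X_lyap : - (Lam *m X) - X *m Lam + Fbar *m Fbar^T = 0)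
  (Yb : forall i : 'I_s, 'M[R]_(mu i))
  (Yb_posdef : forall i, sym_posdef (Yb i))
  (YE : Y = castmx (mu_sum, mu_sum) (\mxdiag_(i < s) Yb i))
  (Y_lyap : loewner_le (- (Lam *m Y) - Y *m Lam + Hbar^T *m Hbar) 0)
  (TG : 'M[R]_N1) (TG_unit : TG \in unitmx)
  (sigma : 'I_N1 -> R)
  (sigma_eig : sqrt_eigenvalues (X *m Y) sigma)
  (TG_X : TG *m X *m TG^T = diag_mx (\row_i sigma i))
  (TG_Y : (invmx TG)^T *m Y *m invmx TG = diag_mx (\row_i sigma i))
  (tau : 'I_n -> R)
  (tau_eig : sqrt_eigenvalues (invmx KM *m Km) tau)
  (* truncation *)
  (k1_le : (k1 <= N1)%N)
  (Lam1 : 'M[R]_k1) (F1 : 'M[R]_(k1, p)) (H1 : 'M[R]_(q, k1))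
  (Lam1E : Lam1 = mxsub (widen_ord k1_le) (widen_ord k1_le) (TG *m Lam *m invmx TG))
  (F1E : F1 = rowsub (widen_ord k1_le) (TG *m Fbar))
  (H1E : H1 = colsub (widen_ord k1_le) (Hbar *m invmx TG))
  (* reduced network *)
  (Tn : 'M[R]_(k1 + 1)) (Tn_unit : Tn \in unitmx)
  (Lhat : 'M[R]_(k1 + 1)) (Fhat : 'M[R]_(k1 + 1, p)) (Hhat : 'M[R]_(q, k1 + 1))
  (LhatE : Lhat = invmx Tn *m block_mx Lam1 0 0 0 *m Tn)
  (Lhat_laplacian : connected_laplacian Lhat)
  (FhatE : Fhat = invmx Tn *m
     col_mx F1 ((Num.sqrt ((N1 + 1)%:R : R))^-1 *: (const_mx 1 *m F)))
  (HhatE : Hhat =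
     row_mx H1 ((Num.sqrt ((N1 + 1)%:R : R))^-1 *: (H *m const_mx 1)) *m Tn) :
  hinf_norm (transfer (network (Lti A B C) L F H)
             - transfer (network (Lti A B C) Lhat Fhat Hhat))
  = hinf_norm (transfer (network (Lti A B C) Lam Fbar Hbar)
               - transfer (network (Lti A B C) Lam1 F1 H1))
  /\ (hinf_norm (transfer (network (Lti A B C) Lam Fbar Hbar)
                 - transfer (network (Lti A B C) Lam1 F1 H1))
      <= (2 * \sum_(i < N1 | (k1 <= i)%N) \sum_(j < n) sigma i * tau j)%:E)%E.
Proof.
set c := (Num.sqrt _)^-1 in T2E FhatE HhatE.
set T := row_mx T1 T2 in T_orthogonal L_decomp.
have T_unit : T \in unitmx by case: (mulmx1_unit T_orthogonal).
have TV : invmx T = T^T.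
  by rewrite -[LHS]mul1mx -T_orthogonal mulmxK.
have T2F : T2^T *m F = c *: (const_mx 1 *m F).
  rewrite T2E scalemxAl; congr (_ *m _).
  by apply/matrixP => i j; rewrite !mxE mulr1.
have HT2 : H *m T2 = c *: (H *m const_mx 1).
  rewrite T2E scalemxAr; congr (_ *m _).
  by apply/matrixP => i j; rewrite !mxE mulr1.
(* the orthogonal [T] provides the coordinates: [Tn = T^T], whose inverse is [T] *)
have full_split : transfer (network (Lti A B C) L F H)
    = transfer (network (Lti A B C) Lam Fbar Hbar)
    + transfer (network (Lti A B C) (0 : 'M[R]_1)
        (c *: (const_mx 1 *m F)) (c *: (H *m const_mx 1))).
  have TT_unit : T^T \in unitmx by rewrite unitmx_tr.
  have TTV : invmx T^T = T by rewrite -trmx_inv TV trmxK.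
  rewrite -(transfer_similar_block _ _ _ _ _ _ TT_unit) TTV -L_decomp.
  rewrite FbarE HbarE -T2F -HT2.
  by rewrite -mul_col_mx -mul_mx_row -tr_row_mx -/T -TV mulKVmx // mulmxK.
have red_split : transfer (network (Lti A B C) Lhat Fhat Hhat)
    = transfer (network (Lti A B C) Lam1 F1 H1)
    + transfer (network (Lti A B C) (0 : 'M[R]_1)
        (c *: (const_mx 1 *m F)) (c *: (H *m const_mx 1))).
  by rewrite LhatE FhatE HhatE; apply: transfer_similar_block.
split; first by rewrite full_split red_split opprD addrACA subrr addr0.
have Lam_sym : Lam^T = Lam by rewrite LamE; apply: tr_castmx_mxdiag.
have X_sym : X^T = X := X_posdef.1.
have S_sym : (diag_mx (\row_i sigma i))^T = diag_mx (\row_i sigma i) by rewrite tr_diag_mx.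
(* symmetry of [Y] follows from its diagonal form in balanced coordinates *)
have YTG : Y = TG^T *m diag_mx (\row_i sigma i) *m TG.
  by rewrite -TG_Y !mulmxA mulmxKV // -trmx_mul mulVmx // trmx1 mul1mx.
have Y_sym : Y^T = Y by rewrite YTG !trmx_mul trmxK S_sym mulmxA.
have sigma_gt0 i : 0 < sigma i.
  have z_neq0 : TG^T *m delta_mx i (0 : 'I_1) != 0.
    apply/eqP => z0; have /(congr1 (mulmx (invmx TG^T))) := z0.
    rewrite mulKmx ?unitmx_tr // mulmx0 => /matrixP/(_ i 0).
    by rewrite !mxE !eqxx => /eqP; rewrite oner_eq0.
  have := X_posdef.2 _ z_neq0; rewrite trmx_mul trmxK !mulmxA -(mulmxA _ TG X).
  by rewrite -(mulmxA _ (TG *m X) TG^T) TG_X trmx_delta -rowE -colE !mxE eqxx mulr1n.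
have [tau_ge0 _ tau_char] := tau_eig.
set bound := 2 * _.
have bound_ge0 : 0 <= bound.
  by rewrite mulr_ge0 ?sumr_ge0 // => i _; rewrite sumr_ge0 // => j _; rewrite mulr_ge0 // ltW.
apply: hinf_norm_le => // z z_gt0.
pose toC := real_complex R.
have z_re : 0 < z + z^*.
  have -> : z + z^* = 2 * toC (complex.Re z).
    by rewrite /toC complexRe ReE mulrC divfK // pnatr_eq0.
  by rewrite mulr_gt0 // (ltcR 0).
have netE N (M : 'M[R]_N) : map_mx toC (1%:M *t A - M *t (B *m C))
    = netmx (map_mx toC A) (map_mx toC B) (map_mx toC C) (map_mx toC M).
  by rewrite /netmx map_mxB !map_mxT map_mx1 map_mxM.
have value N (M : 'M[R]_N) (FN : 'M[R]_(N, p)) (HN : 'M[R]_(q, N)) :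
    let sM := z%:M - netmx (map_mx toC A) (map_mx toC B) (map_mx toC C) (map_mx toC M) in
    sM \in unitmx ->
    ratmx_value (transfer (network (Lti A B C) M FN HN)) z
      ((map_mx toC HN *t map_mx toC C) *m invmx sM *m (map_mx toC FN *t map_mx toC B)).
  by have := @transfer_value R _ _ _ (network (Lti A B C) M FN HN) z; rewrite /= netE !map_mxT.
have tau_charC : char_poly (invmx (map_mx toC KM) *m map_mx toC Km)
    = \prod_j ('X - ((toC \o tau) j ^+ 2)%:P).
  rewrite -map_invmx -map_mxM -map_char_poly tau_char map_prod_XsubC.
  by apply: eq_bigr => j _; rewrite rmorphXn.
have X_lyapC : psd (map_mx toC Lam *m map_mx toC X + map_mx toC X *m (map_mx toC Lam)^t*
    - map_mx toC Fbar *m (map_mx toC Fbar)^t*).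
  rewrite !adjmx_real Lam_sym -!map_mxM -map_mxD -map_mxB.
  have -> : Lam *m X + X *m Lam - Fbar *m Fbar^T = 0.
    by apply: oppr_inj; rewrite oppr0 -X_lyap opprB opprD addrC.
  by rewrite map_mx0; apply: psd0.
have Y_lyapC : psd ((map_mx toC Lam)^t* *m map_mx toC Y + map_mx toC Y *m map_mx toC Lam
    - (map_mx toC Hbar)^t* *m map_mx toC Hbar).
  rewrite !adjmx_real Lam_sym -!map_mxM -map_mxD -map_mxB.
  have -> : Lam *m Y + Y *m Lam - Hbar^T *m Hbar
      = - (- (Lam *m Y) - Y *m Lam + Hbar^T *m Hbar).
    by rewrite opprD opprB opprK (addrC (Y *m Lam)).
  rewrite map_mxN; apply: psd_loewner => //.
  rewrite !linearD !linearN /= !trmx_mul trmxK Lam_sym Y_sym.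
  by rewrite [- _ - _]addrC.
have diagC : map_mx toC (diag_mx (\row_i sigma i)) = diag_mx (\row_i (toC \o sigma) i).
  by rewrite map_diag_mx; congr diag_mx; apply/rowP => i; rewrite !mxE.
have TG_XC : map_mx toC TG *m map_mx toC X *m (map_mx toC TG)^t*
    = diag_mx (\row_i (toC \o sigma) i).
  by rewrite adjmx_real -!map_mxM TG_X.
have TG_YC : (invmx (map_mx toC TG))^t* *m map_mx toC Y *m invmx (map_mx toC TG)
    = diag_mx (\row_i (toC \o sigma) i).
  by rewrite -map_invmx adjmx_real -!map_mxM TG_Y.
have tau_ge0C j : 0 <= (toC \o tau) j by rewrite /= ler0c.
have sigma_gt0C i : 0 < (toC \o sigma) i by rewrite /= (ltcR 0).
have XC : (map_mx toC X)^t* = map_mx toC X by rewrite adjmx_real X_sym.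
have YC : (map_mx toC Y)^t* = map_mx toC Y by rewrite adjmx_real Y_sym.
have TGC : map_mx toC TG \in unitmx by rewrite map_unitmx.
have h_inj : injective (widen_ord k1_le) by move=> i j ij; apply: val_inj; exact: (congr1 val ij).
have := network_bound (storage_complexify KM_max.1) (storage_complexify Km_min.1) tau_ge0C
  tau_charC XC YC X_lyapC Y_lyapC TGC sigma_gt0C TG_XC TG_YC h_inj z_re.
rewrite /= -map_invmx -!map_mxM -!map_mxsub -Lam1E -F1E -H1E.
move=> [full_unit red_unit network_err]; exists
  ((map_mx toC Hbar *t map_mx toC C) *m
     invmx (z%:M - netmx (map_mx toC A) (map_mx toC B) (map_mx toC C) (map_mx toC Lam)) *m
     (map_mx toC Fbar *t map_mx toC B)
   - (map_mx toC H1 *t map_mx toC C) *m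
     invmx (z%:M - netmx (map_mx toC A) (map_mx toC B) (map_mx toC C) (map_mx toC Lam1)) *m
     (map_mx toC F1 *t map_mx toC B)).
  by apply: ratmx_valueB; apply: value.
move=> v; apply: le_trans (network_err v) _; rewrite le_eqVlt; apply/orP; left.
apply/eqP; congr (_ ^+ 2 * _); rewrite rmorphM rmorph_nat rmorph_sum /=; congr (_ * _).
apply: eq_big => [i|i _].
  apply/idP/idP => [i_out|le_ki].
    rewrite leqNgt; apply: contra i_out => lt_ik; apply/codomP.
    by exists (Ordinal lt_ik); apply: val_inj.
  by apply/negP => /codomP[j ij]; rewrite ij /= leqNgt ltn_ord in le_ki.
by rewrite rmorph_sum; apply: eq_bigr => j _; rewrite rmorphM.
Qed.
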